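(* Let $M\in\mathbb{C}^{p\times p}$ be invertible, let $\mathcal{A}\in\mathbb{C}^{m\times m\times p}$ and $\mathcal{B}\in\mathbb{C}^{n\times n\times p}$ be nonsingular, let $\mathcal{C}\in\mathbb{C}^{m\times n\times p}$, and let $\mathcal{A}=\mathcal{F}_1-\mathcal{G}_1$ and $\mathcal{B}=\mathcal{F}_2-\mathcal{G}_2$ with $\mathcal{F}_1,\mathcal{F}_2$ nonsingular. Let $0<\alpha<\frac{2}{1+\rho(\mathcal{F}_1^{-1}*_M\mathcal{G}_1)}$ and $0<\beta<\frac{2}{1+\rho(\mathcal{F}_2^{-1}*_M\mathcal{G}_2)}$. Given $\mathcal{X}_0\in\mathbb{C}^{m\times n\times p}$ and $\mathcal{Y}_0=\mathcal{X}_0*_M\mathcal{B}$, define for $k\ge 0$ $$\mathcal{Y}_{k+1}=(\mathcal{I}_{mmp}-\alpha\mathcal{F}_1^{-1}*_M\mathcal{A})*_M\mathcal{Y}_k+\alpha\mathcal{F}_1^{-1}*_M\mathcal{C},$$ $$\mathcal{X}_{k+1}=\mathcal{X}_k*_M(\mathcal{I}_{nnp}-\beta\mathcal{B}*_M\mathcal{F}_2^{-1})+\beta\mathcal{Y}_{k+1}*_M\mathcal{F}_2^{-1}.$$ If $\rho(\mathcal{F}_1^{-1}*_M\mathcal{G}_1)<1$ and $\rho(\mathcal{F}_2^{-1}*_M\mathcal{G}_2)<1$, then for every initial tensor $\mathcal{X}_0$ (with $\mathcal{Y}_0=\mathcal{X}_0*_M\mathcal{B}$) the sequence $\{\mathcal{X}_k\}$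 converges to $\mathcal{A}^{-1}*_M\mathcal{C}*_M\mathcal{B}^{-1}$.
   Context: For $\mathcal{A}\in\mathbb{C}^{m\times n\times p}$, $\mathcal{A}(:,:,i)\in\mathbb{C}^{m\times n}$ ($1\le i\le p$) denotes the $i$-th frontal slice. For the fixed invertible matrix $M\in\mathbb{C}^{p\times p}$, $\tilde{\mathcal{A}}:=\mathcal{A}\times_3 M$ is defined by $\tilde{\mathcal{A}}(i_1,i_2,k)=\sum_{i_3=1}^p \mathcal{A}(i_1,i_2,i_3)M(k,i_3)$. The $M$-product of $\mathcal{A}\in\mathbb{C}^{m\times n\times p}$ and $\mathcal{B}\in\mathbb{C}^{n\times k\times p}$ is the tensor $\mathcal{A}*_M\mathcal{B}\in\mathbb{C}^{m\times k\times p}$ given by $\mathcal{A}*_M\mathcal{B}=\mathcal{W}\times_3 M^{-1}$, where $\mathcal{W}(:,:,i)=\tilde{\mathcal{A}}(:,:,i)\,\tilde{\mathcal{B}}(:,:,i)$ for $i=1,\dots,p$. The identity tensor $\mathcal{I}_{mmp}\in\mathbb{C}^{m\times m\times p}$ is the tensor such that each $\tilde{\mathcal{I}}_{mmp}(:,:,i)$ is the $m\times m$ identity matrix. $\mathcal{A}\in\mathbb{C}^{m\times m\times p}$ is nonsingular (invertible) if there is $\mathcal{Z}=:\mathcal{A}^{-1}$ with $\mathcal{A}*_M\mathcal{Z}=\mathcal{Z}*_M\mathcal{A}=\mathcal{I}_{mmp}$. The spectral radius of $\mathcal{A}\in\mathbb{C}^{m\times m\times p}$ is $\rho(\mathcal{A})=\max_{1\le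 i\le p}\rho(\tilde{\mathcal{A}}(:,:,i))$. Convergence of tensors is in the finite-dimensional space (entrywise). *)

(* Defs.v *)
From HB Require Import structures.
From mathcomp Require Import all_boot all_order all_algebra.
From mathcomp Require Import complex.
From mathcomp Require Import all_classical all_reals all_analysis.

Set Implicit Arguments.
Unset Strict Implicit.
Unset Printing Implicit Defensive.

Import Order.TTheory GRing.Theory Num.Theory.
Import numFieldNormedType.Exports.

Local Open Scope classical_set_scope.
Local Open Scope ring_scope.
Local Open Scope complex_scope.

(* A third-order tensor is its family of frontal slices: [T k i j] is the entry
   with row i, column j and third index k, and [T k] is T(:,:,k). Addition and
   scaling are the library's pointwise operations on finite functions. *)
Notation tensor R m n p := {ffun 'I_p -> 'M[R[i]]_(m, n)}.

Definition mode3 (R : realType) (m n p : nat)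
    (T : tensor R m n p) (M : 'M[R[i]]_p) : tensor R m n p :=
  [ffun k => \matrix_(i, j) \sum_(l < p) T l i j * M k l].

Definition tmul (R : realType) (m n q p : nat) (M : 'M[R[i]]_p)
    (A : tensor R m n p) (B : tensor R n q p) : tensor R m q p :=
  mode3 [ffun k => mode3 A M k *m mode3 B M k] (invmx M).

Notation "A '*t[' M ] B" := (tmul M A B)
  (at level 40, left associativity, format "A  '*t[' M ]  B") : ring_scope.

(* For invertible M, the unique tensor whose transform along the third mode has
   all its frontal slices equal to the identity matrix. *)
Definition tid (R : realType) (m p : nat) (M : 'M[R[i]]_p) : tensor R m m p :=
  mode3 [ffun _ => 1%:M] (invmx M).

Definition is_tinv (R : realType) (m p : nat) (M : 'M[R[i]]_p)
    (A Z : tensor R m m p) : Prop :=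
  A *t[M] Z = tid m M /\ Z *t[M] A = tid m M.

Definition nonsingular (R : realType) (m p : nat) (M : 'M[R[i]]_p)
    (A : tensor R m m p) : Prop := exists Z, is_tinv M A Z.

(* Takes the junk value 0 when A is singular. *)
Definition tinv (R : realType) (m p : nat) (M : 'M[R[i]]_p)
    (A : tensor R m m p) : tensor R m m p :=
  xget 0 [set Z | is_tinv M A Z].

(* Real-valued. The set of moduli is finite, and nonempty when 0 < m, so that
   the supremum is then a maximum; it is 0 when m = 0. *)
Definition spectral_radius (R : realType) (m : nat) (A : 'M[R[i]]_m) : R :=
  sup [set Normc.normc l | l in [set l : R[i] | eigenvalue A l]].

Definition tspectral_radius (R : realType) (m p : nat) (M : 'M[R[i]]_p)
    (A : tensor R m m p) : R :=
  \big[Num.max/0]_(k < p) spectral_radius (mode3 A M k).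

(* Entrywise convergence; [^o] selects the topology of the modulus on R[i]. *)
Definition tensor_cvg (R : realType) (m n p : nat)
    (X : nat -> tensor R m n p) (L : tensor R m n p) : Prop :=
  forall (k : 'I_p) (i : 'I_m) (j : 'I_n),
    X t k i j @[t --> \oo] --> (L k i j : R[i]^o).

(* Main.v *)
(* Transforming along the third mode decouples the iteration into its frontal
   slices. There the error of Y_k satisfies e' = S e with S = I - alpha F1^-1 A
   = (1 - alpha) I + alpha F1^-1 G1, and the error of X_k satisfies an affine
   recursion with the analogous matrix acting on the right and an inhomogeneity
   proportional to the error of Y_{k+1}. The bounds on alpha and beta put all
   eigenvalues of both matrices inside the unit disc. An affine recursion
   v' = S v + w with w -> 0 then has v -> 0: applying the factors S - l of the
   characteristic polynomial successively to v ends at 0 by Cayley-Hamilton, and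
   undoing the factors one at a time is the scalar recursion x' = l x + z with
   |l| < 1 and z -> 0. *)

Require Import Defs.
From HB Require Import structures.
From mathcomp Require Import all_boot all_order all_algebra.
From mathcomp Require Import complex lra.
From mathcomp Require Import all_classical all_reals all_analysis.

Set Implicit Arguments.
Unset Strict Implicit.
Unset Printing Implicit Defensive.

Import Order.TTheory GRing.Theory Num.Theory.
Import numFieldNormedType.Exports.

Local Open Scope classical_set_scope.
Local Open Scope ring_scope.
Local Open Scope complex_scope.

(** * Scalar recursions with a vanishing perturbation *)

Lemma contraction_cvg0 (R : realType) (r : R) (a b : R^nat) :
  0 <= r < 1 -> (forall t, 0 <= a t) -> (forall t, a t.+1 <= r * a t + b t) ->
  b @ \oo --> 0 -> a @ \oo --> 0.
Proof.
move=> /andP[r0 r1] a0 aS b0; apply/cvgr0Pnorm_lt => e e0.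
(* Perturbations below this size keep the bound [e / 2] stable under one step, since
   [r * (e / 2) + e / 2 * (1 - r) = e / 2]; this drives the induction in [le_aN]. *)
have d0 : 0 < e / 2 * (1 - r) by nra.
have /cvgr0Pnorm_lt /(_ _ d0) [N _ bN] := b0.
have le_aN k : a (k + N)%N <= r ^+ k * a N + e / 2.
  elim: k => [|k IH]; first by rewrite expr0 mul1r add0n; lra.
  have /ltr_normlW bk := bN (k + N)%N (leq_addl _ _).
  have := aS (k + N)%N; rewrite addSn exprS; nra.
have rk0 : (fun k => r ^+ k * a N) @ \oo --> 0.
  rewrite -[0](mul0r (a N)); apply: cvgMr_tmp.
  by apply: cvg_expr; rewrite ger0_norm.
have e20 : 0 < e / 2 by lra.
have /cvgr0Pnorm_lt /(_ _ e20) [K _ rK] := rk0.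
exists (K + N)%N => // t /= lt_t; rewrite ger0_norm //.
have leNt : (N <= t)%N by apply: leq_trans lt_t; exact: leq_addl.
rewrite -(subnK leNt).
have /rK /= /ltr_normlW : (K <= t - N)%N by rewrite leq_subRL // addnC.
by have := le_aN (t - N)%N; lra.
Qed.

Lemma normc_ge0 (R : rcfType) (x : R[i]) : 0 <= Normc.normc x.
Proof. by case: x => a b; exact: sqrtr_ge0. Qed.

Lemma complex_cvg0P (R : realType) (x : nat -> R[i]) :
  x t @[t --> \oo] --> (0 : R[i]^o) <->
  Normc.normc (x t) @[t --> \oo] --> (0 : R).
Proof.
have cvgE := @cvgr0Pnorm_lt R[i] R[i]^o nat \oo _ x.
split=> [/cvgE x0|/cvgr0Pnorm_lt x0].
  apply/cvgr0Pnorm_lt => e e0; have /x0 : 0 < e%:C by rewrite ltcR.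
  by apply: filterS => t; rewrite ltcR [X in _ -> X < _]ger0_norm ?normc_ge0.
(* Here the radius is a complex number; being positive in the order of [R[i]], it has imaginary part
   0. *)
apply/cvgE => -[e i]; rewrite ltcE /= => /andP[/eqP-> /x0].
by apply: filterS => t; rewrite ger0_norm ?normc_ge0 // -ltcR.
Qed.

Lemma scalar_affine_cvg0 (R : realType) (l : R[i]) (x z : nat -> R[i]) :
  Normc.normc l < 1 -> (forall t, x t.+1 = l * x t + z t) ->
  z t @[t --> \oo] --> (0 : R[i]^o) -> x t @[t --> \oo] --> (0 : R[i]^o).
Proof.
move=> l1 xS /complex_cvg0P z0; apply/complex_cvg0P.
apply: (contraction_cvg0 (r := Normc.normc l)) z0 => [|t|t].
- by rewrite normc_ge0 l1.
- exact: normc_ge0.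
- by rewrite xS -Normc.normcM; exact: le_normcD.
Qed.

(** * Matrix sequences tending entrywise to zero *)

Definition mx_cvg0 (R : realType) (m n : nat) (V : nat -> 'M[R[i]]_(m, n)) :=
  forall i j, V t i j @[t --> \oo] --> (0 : R[i]^o).

Lemma lincomb_cvg0 (R : realType) (p : nat) (c : 'I_p -> R[i])
    (x : nat -> 'I_p -> R[i]) :
  (forall l, x t l @[t --> \oo] --> (0 : R[i]^o)) ->
  \sum_l x t l * c l @[t --> \oo] --> (0 : R[i]^o).
Proof.
move=> x0.
have : \sum_l x t l * c l @[t --> \oo] --> (\sum_(l < p) 0 : R[i]^o).
  apply: (@cvg_big R[i]^o _ +%R 0 predT (@add_continuous R[i]^o) _ \oo) => l _.
  by rewrite -(mul0r (c l)); apply: (@cvgMr_tmp R[i]).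
by rewrite big1.
Qed.

Lemma mx_cvg0D (R : realType) m n (V W : nat -> 'M[R[i]]_(m, n)) :
  mx_cvg0 V -> mx_cvg0 W -> mx_cvg0 (fun t => V t + W t).
Proof.
move=> V0 W0 i j; under eq_fun do rewrite mxE.
by rewrite -[0](addr0 0); apply: (@cvgD _ R[i]^o).
Qed.

Lemma mx_cvg0_mulr (R : realType) m n q (V : nat -> 'M[R[i]]_(m, n))
    (Q : 'M[R[i]]_(n, q)) :
  mx_cvg0 V -> mx_cvg0 (fun t => V t *m Q).
Proof.
move=> V0 i j; under eq_fun do rewrite mxE.
exact: (@lincomb_cvg0 _ _ _ (fun t l => V t i l)).
Qed.

Lemma mx_cvg0_tr (R : realType) m n (V : nat -> 'M[R[i]]_(m, n)) :
  mx_cvg0 V -> mx_cvg0 (fun t => (V t)^T).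
Proof. by move=> V0 i j; under eq_fun do rewrite mxE; apply: V0. Qed.

Lemma mx_cvg0_mull (R : realType) m n q (V : nat -> 'M[R[i]]_(m, n))
    (Q : 'M[R[i]]_(q, m)) :
  mx_cvg0 V -> mx_cvg0 (fun t => Q *m V t).
Proof.
move=> /mx_cvg0_tr /(mx_cvg0_mulr Q^T) /mx_cvg0_tr.
by under eq_fun do rewrite trmx_mul !trmxK.
Qed.

(** * Affine matrix recursions *)

Definition mx_of_roots (R : realType) m (S : 'M[R[i]]_m) (s : seq R[i]) :=
  foldr (fun l N => N *m (S - l%:M)) 1%:M s.

(** Since [S] commutes with [S - l], the sequence [(S - l) V] obeys the same recursion with
    perturbation [(S - l) W]. The head of [s] is the rightmost factor of [mx_of_roots], so the
    induction hypothesis for the tail applies to that sequence. *)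
Lemma annihilated_affine_cvg0 (R : realType) m n (S : 'M[R[i]]_m) (s : seq R[i])
    (V W : nat -> 'M[R[i]]_(m, n)) :
  all (fun l => Normc.normc l < 1) s ->
  (forall t, V t.+1 = S *m V t + W t) -> mx_cvg0 W ->
  mx_cvg0 (fun t => mx_of_roots S s *m V t) -> mx_cvg0 V.
Proof.
elim: s V W => [|l s IH] V W /=.
  by move=> _ _ _; under eq_fun do rewrite mul1mx.
move=> /andP[l1 s1] VS W0 V0.
have SlV0 : mx_cvg0 (fun t => (S - l%:M) *m V t).
  apply: (IH _ (fun t => (S - l%:M) *m W t)) => // [t||].
  - rewrite VS mulmxDr !mulmxA mulmxBl mulmxBr.
    by rewrite -scalemx1 -scalemxAl -scalemxAr mul1mx mulmx1.
  - exact: mx_cvg0_mull.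
  - by under eq_fun do rewrite mulmxA.
(* Entrywise, [V t.+1 = l V t + z t], where [z] collects the two vanishing terms [(S - l) V t] and
   [W t]. *)
move=> i j; pose z t := ((S - l%:M) *m V t + W t) i j.
apply: (scalar_affine_cvg0 (z := z) l1).
  move=> t; have -> : V t.+1 = l *: V t + ((S - l%:M) *m V t + W t).
    by rewrite VS mulmxBl mul_scalar_mx addrA (addrC (l *: _)) subrK.
  by rewrite [LHS]mxE [X in X + _]mxE.
exact: mx_cvg0D.
Qed.

Lemma affine_cvg0 (R : realType) m n (S : 'M[R[i]]_m)
    (V W : nat -> 'M[R[i]]_(m, n)) :
  (forall l, eigenvalue S l -> Normc.normc l < 1) ->
  (forall t, V t.+1 = S *m V t + W t) -> mx_cvg0 W -> mx_cvg0 V.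
Proof.
(* Evaluating polynomials at [S] requires a matrix ring of positive size; with no rows there is no
   entry to treat. *)
case: m S V W => [|m] S V W S1 VS W0; first by move=> [].
have [s sE] := closed_field_poly_normal (char_poly S).
move: sE; rewrite (monicP (char_poly_monic S)) scale1r => sE.
apply: (annihilated_affine_cvg0 (s := s)) VS W0 _.
  apply/allP => l ls; apply: S1; rewrite eigenvalue_root_char sE.
  by rewrite root_prod_XsubC.
have -> : mx_of_roots S s = horner_mx S (char_poly S).
  rewrite sE; elim: s {sE} => [|l s IH] /=.
    by rewrite big_nil (rmorph1 (horner_mx S)).
  rewrite big_cons mulrC (rmorphM (horner_mx S)) /= IH rmorphB /=.
  by rewrite horner_mx_X horner_mx_C.
rewrite Cayley_Hamilton => i j; under eq_fun do rewrite mul0mx mxE.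
exact: (@cvg_cst R[i]^o).
Qed.

Lemma eigenvalue_tr (F : fieldType) m (S : 'M[F]_m) l :
  eigenvalue S^T l = eigenvalue S l.
Proof.
rewrite !eigenvalue_root_char; congr (root _ _).
rewrite /char_poly -[in RHS]det_tr; congr (\det _).
by rewrite /char_poly_mx raddfB /= tr_scalar_mx map_trmx.
Qed.

Lemma affine_cvg0_right (R : realType) m n (S : 'M[R[i]]_n)
    (V W : nat -> 'M[R[i]]_(m, n)) :
  (forall l, eigenvalue S l -> Normc.normc l < 1) ->
  (forall t, V t.+1 = V t *m S + W t) -> mx_cvg0 W -> mx_cvg0 V.
Proof.
move=> S1 VS /mx_cvg0_tr W0.
have : mx_cvg0 (fun t => (V t)^T).
  apply: (affine_cvg0 (S := S^T)) W0 => [l|t]; last first.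
    by rewrite VS raddfD /= trmx_mul.
  by rewrite eigenvalue_tr; apply: S1.
by move=> /mx_cvg0_tr; under eq_fun do rewrite trmxK.
Qed.

(** * Eigenvalues and the spectral radius *)

Lemma eigenvalue_swap (F : fieldType) m (f g : 'M[F]_m) l :
  f \in unitmx -> eigenvalue (g *m invmx f) l = eigenvalue (invmx f *m g) l.
Proof.
move=> fU; apply/eigenvalueP/eigenvalueP => -[v vE v0].
  exists (v *m f).
    by rewrite mulmxA mulmxK // scalemxAl -vE -!mulmxA mulVmx // mulmx1.
  by apply: contraNneq v0 => vf0; rewrite -(mulmxK fU v) vf0 mul0mx.
exists (v *m invmx f).
  by rewrite scalemxAl -vE !mulmxA.
by apply: contraNneq v0 => vf0; rewrite -(mulmxKV fU v) vf0 mul0mx.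
Qed.

Lemma eigenvalue_le_spectral_radius (R : realType) m (S : 'M[R[i]]_m) l :
  eigenvalue S l -> Normc.normc l <= spectral_radius S.
Proof.
move=> Sl; apply: ub_le_sup; last by exists l.
have [s sE] := closed_field_poly_normal (char_poly S).
(* The eigenvalues are among the finitely many roots [s] of the characteristic polynomial, which
   bounds the set under [sup]. *)
exists (\big[Num.max/0]_(x <- s) Normc.normc x) => _ /= [x + <-].
rewrite eigenvalue_root_char sE (monicP (char_poly_monic S)) scale1r.
by rewrite root_prod_XsubC => xs; apply: le_bigmax_seq.
Qed.

(* An eigenvalue of the relaxed matrix is (1 - a) + a mu with mu an eigenvalue
   of T, so its modulus is at most |1 - a| + a rho. *)
Lemma relaxation_eigenvalue (R : realType) m (T : 'M[R[i]]_m) (a rho : R) l :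
  0 <= rho < 1 -> 0 < a < 2 / (1 + rho) ->
  (forall mu, eigenvalue T mu -> Normc.normc mu <= rho) ->
  eigenvalue (1%:M - a%:C *: (1%:M - T)) l -> Normc.normc l < 1.
Proof.
move=> /andP[rho0 rho1] /andP[a0]; rewrite ltr_pdivlMr; last by lra.
move=> a2 Trho /eigenvalueP[v vE v0].
have aC0 : a%:C != 0 by rewrite gt_eqF // ltcR.
pose mu := (l - (1 - a%:C)) / a%:C.
have lE : l = (1 - a)%:C + a%:C * mu.
  by rewrite /mu rmorphB rmorph1 /= mulrCA mulfV // mulr1 addrC subrK.
have {}/Trho mu_rho : eigenvalue T mu.
  apply/eigenvalueP; exists v => //.
  move: vE; rewrite mulmxBr mulmx1 -scalemxAr mulmxBr mulmx1 => vE.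
  apply: (scalerI aC0); rewrite scalerA.
  have -> : a%:C * mu = l - (1 - a%:C).
    by rewrite lE rmorphB rmorph1 addrAC subrr add0r.
  rewrite scalerBl -vE scalerBr scalerBl scale1r !opprB !addrA subrK.
  by rewrite [RHS]addrAC subrr add0r.
have normcR (x : R) : Normc.normc x%:C = `|x|.
  by rewrite /Normc.normc /= expr0n addr0 sqrtr_sqr.
rewrite lE; apply: le_lt_trans (le_normcD _ _) _.
rewrite Normc.normcM !normcR (gtr0_norm a0).
have : a * Normc.normc mu <= a * rho by rewrite ler_pM2l.
have : a * rho < a by rewrite gtr_pMr.
(* If [a <= 1] the bound is [1 - a + a * rho], below 1 because [rho < 1]; otherwise it is
   [a * (1 + rho) - 1], below 1 by the upper bound on [a]. *)
by case: (ger0P (1 - a)) => ?; lra.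
Qed.

(** * The transform along the third mode *)

Section Transform.
Variables (R : realType) (p : nat) (M : 'M[R[i]]_p).

Lemma mode3D m n (A B : tensor R m n p) k :
  mode3 (A + B) M k = mode3 A M k + mode3 B M k.
Proof.
rewrite !ffunE; apply/matrixP => i j; rewrite !mxE -big_split /=.
by apply: eq_bigr => l _; rewrite !ffunE mxE mulrDl.
Qed.

Lemma mode3Z m n a (A : tensor R m n p) k :
  mode3 (a *: A) M k = a *: mode3 A M k.
Proof.
rewrite !ffunE; apply/matrixP => i j; rewrite !mxE mulr_sumr.
by apply: eq_bigr => l _; rewrite !ffunE mxE mulrA.
Qed.

Lemma mode3B m n (A B : tensor R m n p) k :
  mode3 (A - B) M k = mode3 A M k - mode3 B M k.
Proof. by rewrite -scaleN1r mode3D mode3Z scaleN1r. Qed.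

Lemma mode3_mode3 m n (T : tensor R m n p) (N P : 'M[R[i]]_p) :
  mode3 (mode3 T P) N = mode3 T (N *m P).
Proof.
apply/ffunP => k; rewrite !ffunE; apply/matrixP => i j; rewrite !mxE.
under eq_bigr do rewrite !ffunE mxE mulr_suml.
rewrite exchange_big; apply: eq_bigr => l _ /=; rewrite mxE mulr_sumr.
by apply: eq_bigr => q _; rewrite -mulrA [P _ _ * _]mulrC.
Qed.

Lemma mode3_1 m n (T : tensor R m n p) : mode3 T 1%:M = T.
Proof.
apply/ffunP => k; rewrite !ffunE; apply/matrixP => i j; rewrite !mxE.
rewrite (bigD1 k) //= big1 => [|l lk]; rewrite mxE ?eqxx ?mulr1 ?addr0 //.
by rewrite eq_sym (negPf lk) mulr0.
Qed.

Hypothesis M_unit : M \in unitmx.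

Lemma mode3K m n (T : tensor R m n p) : mode3 (mode3 T M) (invmx M) = T.
Proof. by rewrite mode3_mode3 mulVmx // mode3_1. Qed.

Lemma mode3VK m n (T : tensor R m n p) : mode3 (mode3 T (invmx M)) M = T.
Proof. by rewrite mode3_mode3 mulmxV // mode3_1. Qed.

Lemma mode3_tmul m n q (A : tensor R m n p) (B : tensor R n q p) k :
  mode3 (A *t[M] B) M k = mode3 A M k *m mode3 B M k.
Proof. by rewrite mode3VK ffunE. Qed.

Lemma mode3_tid m k : mode3 (tid m M) M k = 1%:M.
Proof. by rewrite mode3VK ffunE. Qed.

Lemma mode3_tinv m (A : tensor R m m p) k : nonsingular M A ->
  mode3 A M k \in unitmx /\ mode3 (tinv M A) M k = invmx (mode3 A M k).
Proof.
(* Nonsingularity makes [xget] return a genuine inverse instead of its default 0. *)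
move=> /(@xgetPex _ 0 [set Z | is_tinv M A Z]) [AZ _].
have {}AZ : mode3 A M k *m mode3 (tinv M A) M k = 1%:M.
  by rewrite -mode3_tmul AZ mode3_tid.
have [AU _] := mulmx1_unit AZ; split=> //.
by rewrite -[RHS]mulmx1 -AZ mulKmx.
Qed.

(** Each entry of [X t - L] is a fixed linear combination of entries of the transformed differences,
    with coefficients from a row of [invmx M]. *)
Lemma tensor_cvg_slices m n (X : nat -> tensor R m n p) (L : tensor R m n p) :
  (forall k, mx_cvg0 (fun t => mode3 (X t) M k - mode3 L M k)) ->
  tensor_cvg X L.
Proof.
move=> X0 k i j; apply: (@cvg_zero R[i] R[i]^o).
have -> : (fun t => X t k i j) - cst (L k i j) =
    fun t => \sum_l (mode3 (X t) M l - mode3 L M l) i j * invmx M k l.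
  apply/funext => t; rewrite -[LHS]/(X t k i j - L k i j).
  rewrite -[in LHS](mode3K L) -[in LHS](mode3K (X t)).
  rewrite [mode3 _ (invmx M) k]ffunE [mode3 (mode3 L M) _ k]ffunE !mxE -sumrB.
  by apply: eq_bigr => l _; rewrite [in RHS]mxE [in RHS]mxE mulrBl.
pose d t l := (mode3 (X t) M l - mode3 L M l) i j.
by apply: (@lincomb_cvg0 _ _ _ d) => l; apply: X0.
Qed.

Lemma eigenvalue_le_tspectral_radius m (A : tensor R m m p) k l :
  eigenvalue (mode3 A M k) l -> Normc.normc l <= tspectral_radius M A.
Proof.
move=> /eigenvalue_le_spectral_radius /le_trans; apply.
exact: (le_bigmax _ (fun k => spectral_radius (mode3 A M k))).
Qed.

Lemma tspectral_radius_ge0 m (A : tensor R m m p) : 0 <= tspectral_radius M A.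
Proof. exact: bigmax_ge_id. Qed.

End Transform.

(** * Convergence of the coupled iteration, slice by slice *)

Theorem theorem3p4 (R : realType) (m n p : nat) (M : 'M[R[i]]_p)
  (A F1 G1 : tensor R m m p) (B F2 G2 : tensor R n n p) (C : tensor R m n p)
  (alpha beta : R)
  (hM : M \in unitmx)
  (hA : nonsingular M A) (hB : nonsingular M B)
  (hAsplit : A = F1 - G1) (hBsplit : B = F2 - G2)
  (hF1 : nonsingular M F1) (hF2 : nonsingular M F2)
  (halpha0 : 0 < alpha)
  (halpha : alpha < 2 / (1 + tspectral_radius M (tinv M F1 *t[M] G1)))
  (hbeta0 : 0 < beta)
  (hbeta : beta < 2 / (1 + tspectral_radius M (tinv M F2 *t[M] G2)))
  (hrho1 : tspectral_radius M (tinv M F1 *t[M] G1) < 1)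
  (hrho2 : tspectral_radius M (tinv M F2 *t[M] G2) < 1) :
  forall (X0 : tensor R m n p) (X Y : nat -> tensor R m n p),
    X 0%N = X0 -> Y 0%N = X0 *t[M] B ->
    (forall k : nat,
       Y k.+1 = (tid m M - alpha%:C *: (tinv M F1 *t[M] A)) *t[M] Y k
                + alpha%:C *: (tinv M F1 *t[M] C)) ->
    (forall k : nat,
       X k.+1 = X k *t[M] (tid n M - beta%:C *: (B *t[M] tinv M F2))
                + beta%:C *: (Y k.+1 *t[M] tinv M F2)) ->
    tensor_cvg X (tinv M A *t[M] C *t[M] tinv M B).
Proof.
move=> X0 X Y _ _ YS XS; apply: (tensor_cvg_slices hM) => k.
have [aU aV] := mode3_tinv hM k hA; have [bU bV] := mode3_tinv hM k hB.
have [f1U f1V] := mode3_tinv hM k hF1; have [f2U f2V] := mode3_tinv hM k hF2.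
set a := mode3 A M k in aU aV; set b := mode3 B M k in bU bV.
set f1 := mode3 F1 M k in f1U f1V; set f2 := mode3 F2 M k in f2U f2V.
set c := mode3 C M k.
have g1E : invmx f1 *m a = 1%:M - invmx f1 *m mode3 G1 M k.
  by rewrite /a hAsplit mode3B mulmxBr mulVmx.
have g2E : b *m invmx f2 = 1%:M - mode3 G2 M k *m invmx f2.
  by rewrite /b hBsplit mode3B mulmxBl mulmxV.
rewrite !(mode3_tmul hM) aV bV -/c.
pose E t := mode3 (Y t) M k - invmx a *m c.
have E0 : mx_cvg0 E.
  apply: (affine_cvg0 (S := 1%:M - alpha%:C *: (invmx f1 *m a)) (W := fun=> 0)).
  - rewrite g1E => l.
    apply: (relaxation_eigenvalue
      (rho := tspectral_radius M (tinv M F1 *t[M] G1))).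
    + by rewrite tspectral_radius_ge0; exact: hrho1.
    + by rewrite halpha0; exact: halpha.
    + move=> mu muE; apply: (@eigenvalue_le_tspectral_radius _ _ M _ _ k).
      by rewrite (mode3_tmul hM) f1V.
  - move=> t; rewrite /E YS mode3D mode3Z !(mode3_tmul hM) mode3B mode3Z.
    rewrite (mode3_tid hM) (mode3_tmul hM) f1V -/a -/c addr0 mulmxBr -!addrA.
    (* [invmx a *m c] is a fixed point of the first recursion, because [invmx f1 *m a] sends it to
       [invmx f1 *m c]. *)
    congr (_ + _); rewrite mulmxBl mul1mx -scalemxAl !mulmxA.
    by rewrite mulmxK // opprB.
  - by move=> i j; under eq_fun do rewrite mxE; exact: (@cvg_cst R[i]^o).
apply: (affine_cvg0_right (S := 1%:M - beta%:C *: (b *m invmx f2))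
  (W := fun t => E t.+1 *m (beta%:C *: invmx f2))).
- rewrite g2E => l.
  apply: (relaxation_eigenvalue
    (rho := tspectral_radius M (tinv M F2 *t[M] G2))).
  + by rewrite tspectral_radius_ge0; exact: hrho2.
  + by rewrite hbeta0; exact: hbeta.
  (* Acting on the right produces [G2 F2^-1], whereas the hypothesis bounds the spectrum of
     [F2^-1 G2]; the two are conjugate by the slice [f2]. *)
  + move=> mu; rewrite eigenvalue_swap // => muE.
    apply: (@eigenvalue_le_tspectral_radius _ _ M _ _ k).
    by rewrite (mode3_tmul hM) f2V.
- move=> t; rewrite XS mode3D mode3Z !(mode3_tmul hM) mode3B mode3Z.
  rewrite (mode3_tid hM) (mode3_tmul hM) f2V -/b /E.
  set S := 1%:M - _; rewrite !mulmxBl -!scalemxAr.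
  (* The limit is moved by [S] exactly by the term that turns [Y k.+1] into its error [E t.+1]. *)
  have -> : invmx a *m c *m invmx b *m S =
      invmx a *m c *m invmx b - beta%:C *: (invmx a *m c *m invmx f2).
    by rewrite mulmxBr mulmx1 -scalemxAr !mulmxA mulmxKV.
  rewrite opprB -!addrA; congr (_ + _).
  by rewrite [RHS]addrC -addrA subrK addrC.
- have E10 : mx_cvg0 (fun t => E t.+1).
    by move=> i j; rewrite (@cvg_shiftS R[i]^o (fun t => E t i j)); apply: E0.
  exact: mx_cvg0_mulr.
Qed.
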